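(* Let $0\le\alpha\le1$ and $\theta\ge0$, and let $(T_n^{\alpha,\theta},n\ge1)$ be an $(\alpha,\theta)$-tree growth process. Then: (a) the delabeled process $(T_n^{\alpha,\theta,\circ},n\ge1)$ has the Markov branching property with splitting rule $$q^\circ(m,n-m)=q_{\alpha,\theta}(n-1,m)+q_{\alpha,\theta}(n-1,n-m),\qquad 1\le m<n/2,$$ $$q^\circ(n/2,n/2)=q_{\alpha,\theta}(n-1,n/2),\qquad\text{if }n\text{ is even},$$ where $$q_{\alpha,\theta}(n,m)=\binom nm\frac{n\alpha-m\alpha+m\theta}{n}\,\frac{[1-\alpha]_{m-1}}{[n-m+\theta]_m}\qquad(1\le m\le n);$$ (b) the labeled process $(T_n^{\alpha,\theta},n\ge1)$ is regenerative in the sense that for each $n\ge1$, conditionally given that the first split of $T_n^{\alpha,\theta}$ is by a partition $\{B,[n]\setminus B\}$ of $[n]$ with $\#B=m$, the relabeled subtrees $\widetilde T_{n,B}^{\alpha,\theta}$ and $\widetilde T_{n,[n]\setminus B}^{\alpha,\theta}$ are independent copies of $T_m^{\alpha,\theta}$ and $T_{n-m}^{\alpha,\theta}$, respectively.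
   Context: Notation: $[n]=\{1,\dots,n\}$; $[x]_k=x(x+1)\cdots(x+k-1)$, $[x]_0=1$; expressions $q_{\alpha,\theta}(n,m)$ of the form $0/0$ (when $\theta=0$, $m=n$) are read as the limit as $\theta\downarrow0$. Trees. Rooted binary trees with leaves labeled by $[n]$ have root and leaves of degree 1 and all other vertices (branch points) of degree 3. The root edge is the edge adjacent to the root. For $n\ge2$ a tree splits at the branch point adjacent to the root into two subtrees, each rooted at that branch point (so each subtree has its own root edge, starting there); the first split of $T_n$ is the partition of $[n]$ into the leaf label sets of these two subtrees. For $B\subset[n]$ one of these label sets, $T_{n,B}$ is the corresponding subtree and $\widetilde T_{n,B}$ is $T_{n,B}$ with leaves relabeled by the increasing bijection $B\to[\#B]$. $(\alpha,\theta)$-tree growth process. $T_1$ is a single edge joining the root and leaf 1; $T_2$ is the Y-shaped tree with leaves 1, 2. For $n\ge2$, given $T_1,\dots,T_n$, an edge $a_n\to c_n$ of $T_n$ (directed away from the root) is selected at random and replaced by three edges $a_n\to b_n$, $b_n\to c_n$, $b_n\to n+1$ with a new branch point $b_n$ and a new leaf $n+1$, giving $T_{n+1}$. Selection rule: let the two subtrees above the branch point adjacent to the root have $m$ and $n-m$ leaves, the latter containing the smallest label. Choose the root edge, the first or the second subtree with probabilities proportional to $\alpha$, $m-\alpha$, $n-m-1+\theta$. If a subtree with at least two leaves was chosen, apply the procedure recursively to it (with its own root edge, number of leaves and smallest label), until a root edge or a single-leaf subtree is chosen; in the latter case its unique edge is selected. $T_n^\circ$ is $T_n$ with labels removed. A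 sequence of random unlabeled rooted binary trees $(T_n^\circ)$, $T_n^\circ$ with $n$ leaves, has the Markov branching property with splitting rule $q^\circ$ if the sizes (numbers of leaves) of the two subtrees at the first split of $T_n^\circ$ are $\{m,n-m\}$ with probability $q^\circ(m,n-m)$, $1\le m\le n/2$, and, conditionally given these sizes, the two subtrees are like independent copies of $T_m^\circ$ and $T_{n-m}^\circ$. *)

(* Defs.v *)
From HB Require Import structures.
From mathcomp Require Import all_boot all_order all_algebra finmap.
From mathcomp Require Import all_classical all_reals all_analysis.

Set Implicit Arguments.
Unset Strict Implicit.
Unset Printing Implicit Defensive.

Import Order.TTheory GRing.Theory Num.Theory.
Import numFieldNormedType.Exports.

Local Open Scope classical_set_scope.
Local Open Scope ring_scope.

(* A rooted binary tree is represented by its part above the root edge: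
   [Leaf x] is a single edge from the root to a leaf, and [Node a b] has a
   branch point adjacent to the root, which is the root of both [a] and [b]. *)
Inductive btree (A : Type) : Type :=
| Leaf of A
| Node of btree A & btree A.

Section BTree.
Context {A : Type}.

Fixpoint nleaves (t : btree A) : nat :=
  if t is Node a b then (nleaves a + nleaves b)%N else 1%N.

Fixpoint tree_map {B : Type} (f : A -> B) (t : btree A) : btree B :=
  match t with
  | Leaf x => Leaf (f x)
  | Node a b => Node (tree_map f a) (tree_map f b)
  end.

Fixpoint btree_encode (t : btree A) : GenTree.tree A :=
  match t with
  | Leaf x => GenTree.Leaf x
  | Node a b => GenTree.Node 0 [:: btree_encode a; btree_encode b]
  end.

Fixpoint btree_decode (g : GenTree.tree A) : option (btree A) :=
  match g with
  | GenTree.Leaf x => Some (Leaf x)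
  | GenTree.Node _ [:: g1; g2] =>
      if (btree_decode g1, btree_decode g2) is (Some a, Some b)
      then Some (Node a b) else None
  | _ => None
  end.

Lemma btree_encodeK : pcancel btree_encode btree_decode.
Proof. by elim=> //= a -> b ->. Qed.

End BTree.

HB.instance Definition _ (A : eqType) :=
  Equality.copy (btree A) (pcan_type (@btree_encodeK A)).
HB.instance Definition _ (A : choiceType) :=
  Choice.copy (btree A) (pcan_type (@btree_encodeK A)).
HB.instance Definition _ (A : countType) :=
  Countable.copy (btree A) (pcan_type (@btree_encodeK A)).

(* Labeled trees are not embedded in the plane. They are represented by their
   planar embedding in which, at every branch point, the second subtree is the
   one containing the smallest label; see [ordered] and [tree_growth_ordered]
   below. With this convention two labeled trees are the same exactly when
   their representatives are equal. *)
Notation ltree := (btree nat).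

Fixpoint min_label (t : ltree) : nat :=
  match t with
  | Leaf k => k
  | Node a b => minn (min_label a) (min_label b)
  end.

Fixpoint ordered (t : ltree) : bool :=
  if t is Node a b
  then [&& ordered a, ordered b & (min_label b < min_label a)%N] else true.

Fixpoint labels (t : ltree) : {fset nat} :=
  match t with
  | Leaf k => [fset k]%fset
  | Node a b => (labels a `|` labels b)%fset
  end.

Definition label_range (n : nat) : {fset nat} :=
  [fset i in iota 1 n]%fset.

Lemma in_label_range (n x : nat) :
  (x \in label_range n) = (0 < x <= n)%N.
Proof. by rewrite in_fset mem_iota add1n ltnS. Qed.

(* On [B], the increasing bijection from [B] to {1, ..., #|B|}. *)
Definition rank (B : {fset nat}) (x : nat) : nat :=
  #|` [fset y in B | (y <= x)%N]%fset |.

Definition relabel (B : {fset nat}) (t : ltree) : ltree := tree_map (rank B) t.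

Definition first_split_is (t : ltree) (B C : {fset nat}) : bool :=
  if t is Node a b
  then ((labels a == B) && (labels b == C))
       || ((labels a == C) && (labels b == B))
  else false.

(* Meaningful when [B] is one of the two blocks of the first split of [t]. *)
Definition split_subtree (t : ltree) (B : {fset nat}) : ltree :=
  if t is Node a b then (if labels a == B then a else b) else t.

(* An edge directed away from the root is given by the path leading from the
   root to it: [[::]] is the root edge, and [false :: e] (resp. [true :: e]) is
   the edge [e] of the first (resp. second) subtree. *)
Definition edge := seq bool.

Fixpoint edges (t : ltree) : seq edge :=
  match t with
  | Leaf _ => [:: [::]]
  | Node a b =>
      [::] :: map (cons false) (edges a) ++ map (cons true) (edges b)
  end.

(* The new leaf comes first because [k] exceeds all labels of [t]. *)
Fixpoint graft (t : ltree) (e : edge) (k : nat) : ltree :=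
  match e, t with
  | [::], _ => Node (Leaf k) t
  | false :: e', Node a b => Node (graft a e' k) b
  | true :: e', Node a b => Node a (graft b e' k)
  | _ :: _, Leaf _ => t
  end.

Section Selection.
Context {R : realType}.
Variables (alpha theta : R).

Definition root_weight : R := alpha.
Definition first_weight (a : ltree) : R := (nleaves a)%:R - alpha.
Definition second_weight (b : ltree) : R := (nleaves b)%:R - 1 + theta.
Definition total_weight (a b : ltree) : R :=
  root_weight + first_weight a + second_weight b.

Fixpoint select_prob (t : ltree) (e : edge) : R :=
  match t, e with
  | Leaf _, [::] => 1
  | Leaf _, _ :: _ => 0
  | Node a b, [::] => root_weight / total_weight a b
  | Node a b, false :: e' =>
      first_weight a / total_weight a b * select_prob a e'
  | Node a b, true :: e' =>
      second_weight b / total_weight a b * select_prob b e'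
  end.

End Selection.

(* [T 0] is unconstrained: processes are indexed by n >= 1. *)
Record tree_growth (R : realType) (alpha theta : R) (d : measure_display)
    (Omega : measurableType d) (P : probability Omega R)
    (T : nat -> Omega -> ltree) : Prop := TreeGrowth {
  growth_measurable : forall n t, (1 <= n)%N ->
    measurable [set w | T n w = t];
  growth1 : forall w, T 1%N w = Leaf 1%N;
  growth2 : forall w, T 2%N w = Node (Leaf 2%N) (Leaf 1%N);
  growth_step : exists E : nat -> Omega -> edge, forall n, (2 <= n)%N ->
    [/\ forall e, measurable [set w | E n w = e],
        forall w, E n w \in edges (T n w),
        forall w, T n.+1 w = graft (T n w) (E n w) n.+1 &
        forall (h : nat -> ltree) (e : edge),
          let past := [set w | forall i, (1 <= i <= n)%N -> T i w = h i] in
          P (past `&` [set w | E n w = e]) =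
          (P past * (select_prob alpha theta (h n) e)%:E)%E ]
}.

Lemma cons_inj (c : bool) : injective (cons c).
Proof. by move=> ? ? []. Qed.

Lemma edges_first (a b : ltree) (e : edge) :
  (false :: e \in edges (Node a b)) = (e \in edges a).
Proof.
rewrite [edges _]/= in_cons mem_cat (mem_map (@cons_inj false)).
by rewrite (_ : _ \in map (cons true) _ = false) ?orbF //; apply/mapP => -[].
Qed.

Lemma edges_second (a b : ltree) (e : edge) :
  (true :: e \in edges (Node a b)) = (e \in edges b).
Proof.
rewrite [edges _]/= in_cons mem_cat (mem_map (@cons_inj true)).
by rewrite (_ : _ \in map (cons false) _ = false) //; apply/mapP => -[].
Qed.

Lemma labels_graft (t : ltree) (e : edge) (k : nat) :
  e \in edges t -> labels (graft t e k) = (k |` labels t)%fset.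
Proof.
elim: t e => [x|a IHa b IHb] [|[] e] //.
- by rewrite edges_second /= => /IHb ->; rewrite fsetUCA.
- by rewrite edges_first /= => /IHa ->; rewrite fsetUA.
Qed.

Lemma min_label_in (t : ltree) : min_label t \in labels t.
Proof.
elim: t => [x|a IHa b IHb] /=; first by rewrite inE.
by rewrite inE /minn; case: ifP; rewrite ?IHa ?IHb ?orbT.
Qed.

Lemma ordered_graft (t : ltree) (e : edge) (k : nat) :
  (forall x, x \in labels t -> (x < k)%N) -> e \in edges t -> ordered t ->
  ordered (graft t e k) /\ min_label (graft t e k) = min_label t.
Proof.
elim: t e => [x|a IHa b IHb] [|[] e] ltk //.
- move=> _ _; have xk : (x < k)%N by apply: ltk; rewrite /= inE.
  by rewrite /= xk (minn_idPr (ltnW xk)).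
- move=> _ Ho; have mk := ltk _ (min_label_in (Node a b)).
  by move: Ho mk => /= -> mk; rewrite mk (minn_idPr (ltnW mk)).
- rewrite edges_second /= => He /and3P[-> Hb Hm].
  have [|//|//|-> ->] := IHb e; last by rewrite Hm.
  by move=> x xb; apply: ltk; rewrite /= inE xb orbT.
- rewrite edges_first /= => He /and3P[Ha -> Hm].
  have [|//|//|-> ->] := IHa e; last by rewrite Hm.
  by move=> x xa; apply: ltk; rewrite /= inE xa.
Qed.

Lemma tree_growth_ordered (R : realType) (alpha theta : R)
    (d : measure_display) (Omega : measurableType d) (P : probability Omega R)
    (T : nat -> Omega -> ltree) (n : nat) (w : Omega) :
  tree_growth alpha theta P T -> (1 <= n)%N ->
  ordered (T n w) /\ labels (T n w) = label_range n.
Proof.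
case=> _ T1 T2 [E step].
have lab_rcons m : label_range m.+1 = (m.+1 |` label_range m)%fset.
  apply/fsetP => x; rewrite in_fset1U !in_label_range [(x <= _.+1)%N]leq_eqVlt ltnS.
  by case: eqVneq => // ->.
have lab1 : label_range 1 = [fset 1%N]%fset.
  by apply/fsetP => -[|[|x]]; rewrite in_label_range in_fset1.
elim: n => [//|[_ _|[_ _|n IHn _]]]; first by rewrite T1.
  by rewrite T2 lab_rcons lab1.
have [IHo IHl] := IHn isT.
have [//|_ Ee -> _] := step n.+2; split; last first.
  by rewrite labels_graft // IHl [RHS]lab_rcons.
apply: (proj1 (ordered_graft _ _ _)) => // x.
by rewrite IHl in_label_range => /andP[].
Qed.

(* Unlabeled trees: isomorphism classes, that is, planar shapes up to exchanging
   the two subtrees at branch points. *)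
Fixpoint shape_iso (s t : btree unit) : bool :=
  match s, t with
  | Leaf _, Leaf _ => true
  | Node a b, Node c e =>
      (shape_iso a c && shape_iso b e) || (shape_iso a e && shape_iso b c)
  | _, _ => false
  end.

Lemma shape_iso_refl : reflexive shape_iso.
Proof. by elim=> //= a -> b ->. Qed.

Lemma shape_iso_sym : symmetric shape_iso.
Proof.
elim=> [x|a IHa b IHb] [y|c e] //=.
by rewrite !IHa !IHb [X in _ || X]andbC.
Qed.

Lemma shape_iso_trans : transitive shape_iso.
Proof.
elim=> [x|a IHa b IHb] [y|c e] [z|f g] //=.
by case/orP=> /andP[h1 h2] /orP[] /andP[h3 h4]; apply/orP;
  [left|right|right|left]; apply/andP; split; eauto.
Qed.

Canonical shape_iso_equiv :=
  EquivRel shape_iso shape_iso_refl shape_iso_sym shape_iso_trans.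

Definition utree := {eq_quot shape_iso}%qT.
HB.instance Definition _ := Choice.on utree.
HB.instance Definition _ := EqQuotient.on utree.

Definition uclass (s : btree unit) : utree := (\pi_utree s)%qT.

Definition delabel (t : ltree) : utree := uclass (tree_map (fun=> tt) t).

Definition uleaves (u : utree) : nat := nleaves (repr u).

(* The tree whose (unordered) pair of subtrees at the first split is {u, v}. *)
Definition ujoin (u v : utree) : utree := uclass (Node (repr u) (repr v)).

Lemma uclass_eq (s t : btree unit) : uclass s = uclass t <-> shape_iso s t.
Proof. by split=> [/eqmodP|/eqmodP]. Qed.

Lemma repr_uclass (s : btree unit) : shape_iso (repr (uclass s)) s.
Proof. by apply/uclass_eq; rewrite /uclass reprK. Qed.

Lemma uleaves_class (s : btree unit) : uleaves (uclass s) = nleaves s.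
Proof.
have iso_leaves : forall t1 t2, shape_iso t1 t2 -> nleaves t1 = nleaves t2.
  elim=> [x|a IHa b IHb] [y|c e] //= /orP[] /andP[/IHa -> /IHb ->] //.
  exact: addnC.
exact/iso_leaves/repr_uclass.
Qed.

Lemma ujoin_class (s t : btree unit) :
  ujoin (uclass s) (uclass t) = uclass (Node s t).
Proof. by apply/uclass_eq; rewrite /= !repr_uclass. Qed.

Lemma ujoin_inj (u v u' v' : utree) :
  ujoin u v = ujoin u' v' <-> (u = u' /\ v = v') \/ (u = v' /\ v = u').
Proof.
have repr_iso (x y : utree) : shape_iso (repr x) (repr y) -> x = y.
  by move/uclass_eq; rewrite /uclass !reprK.
split=> [/uclass_eq /=|].
  by case/orP=> /andP[/repr_iso-> /repr_iso->]; [left|right].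
by move=> [[-> ->]//|[-> ->]]; apply/uclass_eq; rewrite /= !shape_iso_refl orbT.
Qed.

Definition cond_prob (R : realType) (d : measure_display)
    (Omega : measurableType d) (P : probability Omega R)
    (A E : set Omega) : R :=
  fine (P (A `&` E)) / fine (P E).

Definition usplit_sizes (u : utree) (m k : nat) : Prop :=
  exists u1 u2, [/\ u = ujoin u1 u2, uleaves u1 = m & uleaves u2 = k].

(* Since [ujoin] is injective on unordered pairs ([ujoin_inj]), the last clause
   says that, given the sizes, the unordered pair of subtrees of [U n] at its
   first split is distributed like the unordered pair formed by independent
   copies of [U m] and [U (n - m)], realized on the square of [P]. *)
Definition markov_branching (R : realType) (d : measure_display)
    (Omega : measurableType d) (P : probability Omega R)
    (U : nat -> Omega -> utree) (q : nat -> nat -> R) : Prop :=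
  [/\ forall n u, (1 <= n)%N -> measurable [set w | U n w = u],
      forall n w, (1 <= n)%N -> uleaves (U n w) = n &
      forall n m, (1 <= m)%N -> (m.*2 <= n)%N ->
        let sizes := [set w | usplit_sizes (U n w) m (n - m)] in
        P sizes = (q m (n - m)%N)%:E /\
        ((0 < P sizes)%E -> forall A : set utree,
          (cond_prob P [set w | A (U n w)] sizes)%:E =
          (P \x P)%E [set w | A (ujoin (U m w.1) (U (n - m)%N w.2))]) ].

Definition regenerative (R : realType) (d : measure_display)
    (Omega : measurableType d) (P : probability Omega R)
    (T : nat -> Omega -> ltree) : Prop :=
  forall (n m : nat) (B : {fset nat}), (1 <= n)%N ->
    (B `<=` label_range n)%fset -> #|` B| = m ->
    let C := (label_range n `\` B)%fset in
    let split := [set w | first_split_is (T n w) B C] in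
    (0 < P split)%E ->
    forall A1 A2 : set ltree,
      (cond_prob P
         [set w | A1 (relabel B (split_subtree (T n w) B)) /\
                  A2 (relabel C (split_subtree (T n w) C))] split)%:E =
      (P [set w | A1 (T m w)] * P [set w | A2 (T (n - m)%N w)])%E.

Definition rising (R : realType) (x : R) (k : nat) : R :=
  \prod_(i < k) (x + i%:R).

Definition q_formula (R : realType) (alpha theta : R) (n m : nat) : R :=
  'C(n, m)%:R
  * ((n%:R * alpha - m%:R * alpha + m%:R * theta) / n%:R)
  * (rising (1 - alpha) m.-1 / rising (n%:R - m%:R + theta) m).

(* For theta = 0 and m = n the formula is 0/0, read as a limit. *)
Definition q_rule (R : realType) (alpha theta : R) (n m : nat) : R :=
  if (theta == 0) && (m == n)
  then lim (q_formula alpha t n m @[t --> 0^'+])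
  else q_formula alpha theta n m.

Definition q_circ (R : realType) (alpha theta : R) (m k : nat) : R :=
  let n := (m + k)%N in
  if m == k then q_rule alpha theta n.-1 m
  else q_rule alpha theta n.-1 m + q_rule alpha theta n.-1 k.

(* Main.v *)
Require Import Defs.
From HB Require Import structures.
From mathcomp Require Import all_boot all_order all_algebra finmap.
From mathcomp Require Import all_classical all_reals all_analysis.
From mathcomp Require Import zify ring lra.

Set Implicit Arguments.
Unset Strict Implicit.
Unset Printing Implicit Defensive.

Import Order.TTheory GRing.Theory Num.Theory.
Import numFieldNormedType.Exports.

Local Open Scope ring_scope.

(** The growth acts on the two subtrees at the first split separately: a new
    leaf either goes to the root edge, where it becomes the whole first subtree
    and the old tree becomes the second one, or it goes to one of the two
    subtrees, with a probability depending only on the sizes; inside that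
    subtree it is then attached by the same selection rule. So the relabeled
    subtrees perform two growths, driven by a clock that sees only the label
    sets of the two sides, and at every time they are independent grown trees
    given the history of these label sets.

    This is made precise by computing with means. [mean n F] is the mean of
    [F] over the tree with [n] leaves, defined by the recursion
    [mean n.+1 F = mean n (grow n.+1 F)], where [grow] averages over the
    selected edge. Selecting an edge commutes with relabeling ([grow_std]), so
    the mean of [phi (labels a) * F (std a) (std b)] over the trees [Node a b]
    whose first subtree has a given size obeys a one-step recursion
    ([mean_split_step]); an induction on [n] then factors it
    ([mean_split_indep]) into the mean of [phi] alone and the mean of [F] over
    two independent grown trees. Taking for [phi] the indicator of one set of
    labels gives the regenerative property, and [phi = 1] gives Markov
    branching.

    For [phi = 1] and [F = 1] the same recursion determines the law of the
    sizes. A given pair of blocks, the first with [m.+1] labels and the second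
    with [k.+1] labels and containing the smallest one, is the first split with
    a probability that depends only on [m], [k] and on the block that contains
    label 2. Counting the blocks of both kinds gives [split_prob], the recursion
    is Pascal's rule ([split_prob_step]), and elementary identities between
    binomial coefficients and rising factorials turn [split_prob] into the
    splitting rule ([q_ruleE]).

    The means describe the given process because a grown tree determines its
    own past: the last leaf can be removed in one way only ([graft_inj]). The
    step axiom of the process, which conditions on the whole past, therefore
    gives the probability of every tree with one more leaf
    ([growth_graft]). *)

(** * Grafting a leaf *)

Lemma nleaves_gt0 (A : Type) (t : btree A) : (0 < nleaves t)%N.
Proof. by elim: t => //= a IHa b IHb; rewrite addn_gt0 IHa. Qed.

Lemma nleaves_tree_map (A B : Type) (f : A -> B) (t : btree A) :
  nleaves (tree_map f t) = nleaves t.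
Proof. by elim: t => //= a -> b ->. Qed.

Lemma tree_map_comp (A B C : Type) (f : B -> C) (g : A -> B) (t : btree A) :
  tree_map f (tree_map g t) = tree_map (f \o g) t.
Proof. by elim: t => //= a -> b ->. Qed.

Lemma eq_in_tree_map (B : Type) (f g : nat -> B) (t : ltree) :
  {in labels t, f =1 g} -> tree_map f t = tree_map g t.
Proof.
elim: t => [x|a IHa b IHb] /= fg; first by rewrite fg // inE.
by rewrite IHa ?IHb // => x xt; apply: fg; rewrite inE xt ?orbT.
Qed.

Lemma tree_map_id (t : ltree) : tree_map id t = t.
Proof. by elim: t => //= a -> b ->. Qed.

Lemma edges_tree_map (f : nat -> nat) (t : ltree) :
  edges (tree_map f t) = edges t.
Proof. by elim: t => //= a -> b ->. Qed.

Lemma edges_uniq (t : ltree) : uniq (edges t).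
Proof.
elim: t => //= a ua b ub.
rewrite cat_uniq !map_inj_uniq ?ua ?ub; [|exact: cons_inj..].
rewrite andbT mem_cat negb_or -andbA; apply/and4P; split=> //.
- by apply/mapP => -[].
- by apply/mapP => -[].
- by apply/hasPn => _ /mapP[e _ ->]; apply/mapP => -[].
Qed.

Lemma nleaves_graft (t : ltree) (e : edge) (k : nat) :
  e \in edges t -> nleaves (graft t e k) = (nleaves t).+1.
Proof.
elim: t e => [x|a IHa b IHb] [|[] e] //=.
- by rewrite edges_second /= => /IHb ->; rewrite addnS.
- by rewrite edges_first /= => /IHa ->.
Qed.

Lemma tree_map_graft (f : nat -> nat) (t : ltree) (e : edge) (k : nat) :
  tree_map f (graft t e k) = graft (tree_map f t) e (f k).
Proof. by elim: t e => [x|a IHa b IHb] [|[] e] //=; rewrite ?IHa ?IHb. Qed.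

Lemma graft_neq_leaf (t : ltree) (e : edge) (k x : nat) :
  e \in edges t -> graft t e k <> Leaf x.
Proof. by case: t e => [y|a b] [|[] e]. Qed.

(** A label that is not in the tree marks the grafted leaf, so both the old tree
    and the selected edge can be read off the new tree. *)
Lemma graft_inj (t t' : ltree) (e e' : edge) (k : nat) :
  k \notin labels t -> k \notin labels t' ->
  e \in edges t -> e' \in edges t' ->
  graft t e k = graft t' e' k -> t = t' /\ e = e'.
Proof.
elim: t t' e e' => [x|a IHa b IHb] [x'|a' b'] [|[] e] [|[] e'];
  rewrite ?edges_first ?edges_second //= ?in_fsetU ?in_fset1 ?negb_or.
- by move=> _ _ _ _ [->].
- by move=> _ /andP[ka' _] _ _ [ea _]; rewrite -ea /= in_fset1 eqxx in ka'.
- by move=> _ _ _ ea' [/esym/graft_neq_leaf]; case.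
- by move=> /andP[ka _] _ _ _ [ea _]; rewrite ea /= in_fset1 eqxx in ka.
- by move=> _ _ ea _ [/graft_neq_leaf]; case.
- by move=> _ _ _ _ [-> ->].
- by move=> _ /andP[ka' _] _ _ [ea _]; rewrite -ea /= in_fset1 eqxx in ka'.
- by move=> _ _ _ ea' [/esym/graft_neq_leaf]; case.
- by move=> /andP[ka _] _ _ _ [ea _]; rewrite ea /= in_fset1 eqxx in ka.
- by move=> /andP[_ kb] /andP[_ kb'] eb eb' [-> /IHb][] // -> ->.
- move=> /andP[ka _] _ _ ea' [ea _].
  by rewrite ea labels_graft // fset1U1 in ka.
- by move=> _ _ ea _ [/graft_neq_leaf]; case.
- move=> _ /andP[ka' _] ea _ [ea' _].
  by rewrite -ea' labels_graft // fset1U1 in ka'.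
- move=> /andP[ka _] /andP[ka' _] ea ea' [/IHa eqa ->].
  by case: eqa => // -> ->.
Qed.

(** * Trees with distinct labels, and their standardization *)

Lemma card_labels_le (t : ltree) : (#|` labels t| <= nleaves t)%N.
Proof.
elim: t => [x|a IHa b IHb] /=; first by rewrite cardfs1.
by rewrite cardfsU (leq_trans (leq_subr _ _)) // leq_add.
Qed.

(** A tree with [n] leaves has [n] labels exactly when no label is repeated. *)
Definition distinct (t : ltree) : bool := #|` labels t| == nleaves t.

Lemma distinct_node (a b : ltree) : distinct (Node a b) ->
  [/\ distinct a, distinct b & (labels a `&` labels b = fset0)%fset].
Proof.
rewrite /distinct /= cardfsU => /eqP ab.
have := card_labels_le a; have := card_labels_le b.
have : (#|` (labels a `&` labels b)%fset| <= #|` labels a|)%N.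
  exact: fsubset_leq_card (fsubsetIl _ _).
move: (@cardfs0_eq _ (labels a `&` labels b)%fset) ab.
move: #|` labels a| #|` labels b| (#|` (labels a `&` labels b)%fset|) => p q r.
by move=> r0 pqr rp qb pa; split; [apply/eqP; lia..|apply: r0; lia].
Qed.

(** For the two subtrees [a] and [b] of a first split, [std a] and [std b] are
    the relabeled subtrees of the regenerative property. *)
Definition std (t : ltree) : ltree := relabel (labels t) t.

Lemma std_leaf (x : nat) : std (Leaf x) = Leaf 1.
Proof.
rewrite /std /relabel /rank /=; congr Leaf.
rewrite (_ : [fset _ in _ | _]%fset = [fset x]%fset) ?cardfs1 //.
by apply/fsetP => y; rewrite !inE; case: eqP => // ->; rewrite leqnn.
Qed.

Lemma edges_std (t : ltree) : edges (std t) = edges t.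
Proof. exact: edges_tree_map. Qed.

(** A label larger than all others receives rank [(nleaves t).+1] and does not
    change the ranks of the other labels: growing a subtree is, after
    relabeling, an ordinary growth step. *)
Lemma std_graft (t : ltree) (e : edge) (k : nat) :
  distinct t -> (forall x, x \in labels t -> (x < k)%N) -> e \in edges t ->
  std (graft t e k) = graft (std t) e (nleaves t).+1.
Proof.
move=> /eqP dt ltk et; rewrite /std /relabel labels_graft // tree_map_graft.
have kt : k \notin labels t by apply/negP => /ltk; rewrite ltnn.
congr graft.
  apply: eq_in_tree_map => x xt; rewrite /rank; congr #|` _|.
  apply/fsetP => y; rewrite !inE; case: eqVneq => [->|//].
  by rewrite leqNgt ltk // (negbTE kt).
rewrite /rank -dt (_ : [fset _ in _ | _]%fset = (k |` labels t)%fset).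
  by rewrite cardfsU1 kt.
apply/fsetP => y; rewrite !inE.
case: eqVneq => [->|_]; rewrite ?leqnn //=.
by case: (boolP (y \in _)) => // /ltk/ltnW.
Qed.

Lemma card_label_range (n : nat) : #|` label_range n| = n.
Proof. by rewrite card_fseq undup_id ?iota_uniq // size_iota. Qed.

Lemma std_id (n : nat) (t : ltree) : labels t = label_range n -> std t = t.
Proof.
move=> ltn; rewrite -[RHS]tree_map_id; apply: eq_in_tree_map => x.
rewrite ltn in_label_range => /andP[x0 xn] /=.
rewrite /rank (_ : [fset _ in _ | _]%fset = label_range x) ?card_label_range //.
apply/fsetP => y; rewrite in_label_range in_fset /= inE /= in_label_range.
by lia.
Qed.

Lemma label_rangeS (n : nat) : label_range n.+1 = (n.+1 |` label_range n)%fset.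
Proof. by apply/fsetP => x; rewrite in_fset1U !in_label_range; lia. Qed.

Lemma label_range1 : label_range 1 = [fset 1%N]%fset.
Proof. by apply/fsetP => x; rewrite in_fset1 in_label_range; lia. Qed.

(** * The trees reached by the growth *)

Fixpoint trees (n : nat) : seq ltree :=
  match n with
  | 0 => [::]
  | n'.+1 => if n' == 0%N then [:: Leaf 1]
             else [seq graft t e n | t <- trees n', e <- edges t]
  end.

Lemma treesS (n : nat) : (0 < n)%N ->
  trees n.+1 = [seq graft t e n.+1 | t <- trees n, e <- edges t].
Proof. by case: n. Qed.

Lemma trees_labels (n : nat) (t : ltree) :
  t \in trees n -> labels t = label_range n /\ nleaves t = n.
Proof.
elim: n t => [//|[_|n IHn]] t.
  by rewrite inE => /eqP -> /=; rewrite label_range1.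
rewrite treesS // => /allpairsPdep[t' [e [/IHn[lt' nt'] et' ->]]].
by rewrite labels_graft // nleaves_graft // lt' nt' [RHS]label_rangeS.
Qed.

Lemma trees_distinct (n : nat) (t : ltree) : t \in trees n -> distinct t.
Proof. by case/trees_labels => lt nt; rewrite /distinct lt nt card_label_range. Qed.

Lemma trees_second_labels (n : nat) (a b : ltree) : Node a b \in trees n ->
  (labels b = label_range n `\` labels a)%fset.
Proof.
move=> abn; have [<- _] := trees_labels abn.
have [_ _ /fsetP disj] := distinct_node (trees_distinct abn).
apply/fsetP => x; move: (disj x); rewrite /= !inE.
by case: (x \in labels a); case: (x \in labels b).
Qed.

Lemma fresh_label (n : nat) (t : ltree) :
  t \in trees n -> n.+1 \notin labels t.
Proof. by case/trees_labels => -> _; rewrite in_label_range ltnn andbF. Qed.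

Lemma trees_uniq (n : nat) : uniq (trees n).
Proof.
elim: n => [//|[//|n] IHn]; rewrite treesS //.
apply: allpairs_uniq_dep => //; first by move=> t _; exact: edges_uniq.
move=> _ _ /allpairsPdep[t [e [tn et ->]]]
  /allpairsPdep[t' [e' [tn' et' ->]]] /=.
by case/graft_inj; rewrite ?fresh_label // => -> ->.
Qed.

(** * The mean of a function of the grown tree *)

Section Mean.
Context {R : realType}.
Context (alpha theta : R) (theta_ge0 : 0 <= theta).

Local Notation sel := (select_prob alpha theta).

Definition grow (k : nat) (F : ltree -> R) (t : ltree) : R :=
  \sum_(e <- edges t) sel t e * F (graft t e k).

(** There is no tree with 0 leaves; the value at 0 is chosen to keep [mean]
    linear. *)
Fixpoint mean (n : nat) (F : ltree -> R) : R :=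
  match n with
  | 0 => 0
  | n'.+1 => if n' == 0%N then F (Leaf 1) else mean n' (grow n F)
  end.

Lemma meanS (n : nat) (F : ltree -> R) :
  (0 < n)%N -> mean n.+1 F = mean n (grow n.+1 F).
Proof. by case: n. Qed.

Lemma eq_grow (k : nat) (F G : ltree -> R) (t : ltree) :
  (forall e, e \in edges t -> F (graft t e k) = G (graft t e k)) ->
  grow k F t = grow k G t.
Proof. by move=> FG; rewrite /grow !big_seq; apply: eq_bigr => e /FG ->. Qed.

Lemma growD (k : nat) (F G : ltree -> R) (t : ltree) :
  grow k (fun x => F x + G x) t = grow k F t + grow k G t.
Proof. by rewrite /grow -big_split; apply: eq_bigr => e _; rewrite mulrDr. Qed.

Lemma growZ (k : nat) (c : R) (F : ltree -> R) (t : ltree) :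
  grow k (fun x => c * F x) t = c * grow k F t.
Proof. by rewrite /grow mulr_sumr; apply: eq_bigr => e _; rewrite mulrCA. Qed.

Lemma eq_mean (n : nat) (F G : ltree -> R) :
  {in trees n, F =1 G} -> mean n F = mean n G.
Proof.
elim: n F G => [//|[_|n IHn]] F G FG; first by apply: FG; rewrite inE.
rewrite meanS // [RHS]meanS //; apply: IHn => t tn; apply: eq_grow => e et.
by apply: FG; rewrite treesS //; apply/allpairsPdep; exists t, e.
Qed.

Lemma meanD (n : nat) (F G : ltree -> R) :
  mean n (fun x => F x + G x) = mean n F + mean n G.
Proof.
elim: n F G => [|[//|n] IHn] F G; first by rewrite addr0.
rewrite meanS // [mean _ F]meanS // [mean _ G]meanS // -IHn.
by apply: eq_mean => t _; apply: growD.
Qed.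

Lemma meanZ (n : nat) (c : R) (F : ltree -> R) :
  mean n (fun x => c * F x) = c * mean n F.
Proof.
elim: n F => [|[//|n] IHn] F; first by rewrite mulr0.
rewrite meanS // [mean _ F]meanS // -IHn.
by apply: eq_mean => t _; apply: growZ.
Qed.

Lemma mean0 (n : nat) : mean n (fun=> 0) = 0.
Proof.
rewrite -[RHS](mul0r (mean n (fun=> 0))) -meanZ.
by apply: eq_mean => t _; rewrite mul0r.
Qed.

Lemma mean_sum (n : nat) (I : Type) (s : seq I) (F : I -> ltree -> R) :
  mean n (fun x => \sum_(i <- s) F i x) = \sum_(i <- s) mean n (F i).
Proof.
elim: s => [|i s IHs].
  by rewrite big_nil -[RHS](mean0 n); apply: eq_mean => t _; rewrite big_nil.
by rewrite big_cons -IHs -meanD; apply: eq_mean => t _; rewrite big_cons.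
Qed.

Lemma mean_grow (n k : nat) (t : ltree) (F : ltree -> ltree -> R) :
  mean n (fun b => grow k (fun a => F a b) t) =
  grow k (fun a => mean n (F a)) t.
Proof. by rewrite /grow mean_sum; apply: eq_bigr => e _; rewrite meanZ. Qed.

Lemma mean_exchange (m n : nat) (F : ltree -> ltree -> R) :
  mean m (fun a => mean n (F a)) = mean n (fun b => mean m (fun a => F a b)).
Proof.
elim: m F => [|[//|m] IHm] F; first by rewrite mean0.
rewrite meanS // -[RHS](eq_mean (fun b _ => esym (meanS _ _))) // -IHm.
by apply: eq_mean => t _; rewrite mean_grow.
Qed.

Lemma total_weightE (a b : ltree) :
  total_weight alpha theta a b = (nleaves (Node a b))%:R - 1 + theta.
Proof.
rewrite /total_weight /root_weight /first_weight /second_weight /= natrD.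
by ring.
Qed.

Lemma total_weight_gt0 (a b : ltree) : 0 < total_weight alpha theta a b.
Proof.
rewrite total_weightE /=; have := nleaves_gt0 a; have := nleaves_gt0 b => b0 a0.
have : (2 : R) <= (nleaves a + nleaves b)%:R by rewrite ler_nat; lia.
by move: theta_ge0; lra.
Qed.

Lemma grow_leaf (k x : nat) (F : ltree -> R) :
  grow k F (Leaf x) = F (Node (Leaf k) (Leaf x)).
Proof. by rewrite /grow /= big_seq1 mul1r. Qed.

(** The selection rule at the first branch point; the weights of the two
    subtrees multiply growth steps inside these subtrees. *)
Lemma grow_node (k : nat) (F : ltree -> R) (a b : ltree) :
  grow k F (Node a b) =
  (alpha * F (Node (Leaf k) (Node a b))
   + first_weight alpha a * grow k (fun a' => F (Node a' b)) a
   + second_weight theta b * grow k (fun b' => F (Node a b')) b)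
  / total_weight alpha theta a b.
Proof.
rewrite /grow [edges _]/= big_cons big_cat !big_map /= addrA.
rewrite [RHS]mulrDl [X in _ = X + _]mulrDl; congr (_ + _ + _).
- by rewrite mulrAC.
- rewrite mulr_sumr mulr_suml; apply: eq_bigr => e _; ring.
- rewrite mulr_sumr mulr_suml; apply: eq_bigr => e _; ring.
Qed.

(** Selection probabilities sum to 1. The total weight at a branch point is the
    number of leaves minus 1 plus [theta], which is positive. *)
Lemma grow_cst (k : nat) (c : R) (t : ltree) : grow k (fun=> c) t = c.
Proof.
elim: t c => [x|a IHa b IHb] c; first by rewrite grow_leaf.
rewrite grow_node IHa IHb -2!mulrDl mulrAC.
rewrite -[X in X / _]/(total_weight alpha theta a b).
by rewrite divff ?mul1r // gt_eqF ?total_weight_gt0.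
Qed.

Lemma mean_cst (n : nat) (c : R) : (0 < n)%N -> mean n (fun=> c) = c.
Proof.
elim: n => [//|[//|n] IHn _]; rewrite meanS // -[RHS]IHn //.
by apply: eq_mean => t _; rewrite grow_cst.
Qed.

Lemma select_tree_map (f : nat -> nat) (t : ltree) (e : edge) :
  sel (tree_map f t) e = sel t e.
Proof.
elim: t e => [x|a IHa b IHb] [|[] e] //=;
  by rewrite ?IHa ?IHb /total_weight /first_weight /second_weight !nleaves_tree_map.
Qed.

(** Selection probabilities depend only on sizes, hence not on labels. *)
Lemma grow_std (k : nat) (F : ltree -> R) (t : ltree) :
  distinct t -> (forall x, x \in labels t -> (x < k)%N) ->
  grow k (fun t' => F (std t')) t = grow (nleaves t).+1 F (std t).
Proof.
move=> dt ltk; rewrite /grow edges_std !big_seq; apply: eq_bigr => e et.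
by rewrite std_graft // /std select_tree_map.
Qed.

(** * Independence of the two subtrees at the first split *)

(** The test functions that separate what is claimed to be independent given the
    sizes: [phi] sees the label set of the first subtree, and thereby the whole
    partition, while [F] sees the two relabeled subtrees. *)
Definition split_fun (m : nat) (phi : {fset nat} -> R)
    (F : ltree -> ltree -> R) (t : ltree) : R :=
  if t is Node a b
  then (nleaves a == m)%:R * phi (labels a) * F (std a) (std b) else 0.

Definition mean_split (n m : nat) (phi : {fset nat} -> R)
    (F : ltree -> ltree -> R) : R := mean n (split_fun m phi F).

Lemma eq_mean_split (n m : nat) phi F G :
  (forall a b, F a b = G a b) -> mean_split n m phi F = mean_split n m phi G.
Proof. by move=> FG; apply: eq_mean => -[x|a b] _ //=; rewrite FG. Qed.

Lemma mean_split0 (n : nat) phi F : mean_split n 0 phi F = 0.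
Proof.
rewrite -[RHS](mean0 n); apply: eq_mean => -[x|a b] _ //=.
by rewrite eqn0Ngt nleaves_gt0 !mul0r.
Qed.

Lemma mean_split_ge (n m : nat) phi F : (n <= m)%N -> mean_split n m phi F = 0.
Proof.
move=> nm; rewrite -[RHS](mean0 n); apply: eq_mean => -[x|a b] //= abn.
case: eqP => [am|_]; last by rewrite !mul0r.
exfalso; have [_ /= abn1] := trees_labels abn.
by have := @nleaves_gt0 nat b; lia.
Qed.

(** A first subtree of size [m.+1] arises in three ways: from a new leaf on the
    root edge, which makes it a single leaf (so [m = 0]), by growing from size
    [m], or by keeping its size while the second subtree grows from size [k].
    The last two terms vanish when [m = 0] or [k = 0], since no subtree is
    empty. *)
Lemma mean_split_step (m k : nat) phi F : (0 < m + k)%N ->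
  mean_split (m + k).+2 m.+1 phi F =
  ((m == 0%N)%:R * alpha * phi [fset (m + k).+2]%fset
     * mean (m + k).+1 (F (Leaf 1))
   + (m%:R - alpha) * mean_split (m + k).+1 m
       (fun B => phi ((m + k).+2 |` B)%fset)
       (fun a b => grow m.+1 (fun a' => F a' b) a)
   + (k%:R - 1 + theta) * mean_split (m + k).+1 m.+1 phi
       (fun a => grow k.+1 (F a)))
  / ((m + k)%:R + theta).
Proof.
move=> mk0; rewrite /mean_split meanS // -!meanZ -!meanD [RHS]mulrC -meanZ.
apply: eq_mean => t tn; have [lt nt] := trees_labels tn.
case: t tn lt nt => [x|a b] tn lt nt; first by move: nt mk0 => /= [<-].
have ltn x : x \in labels a -> (x < (m + k).+2)%N.
  move=> xa; suff : x \in label_range (m + k).+1 by rewrite in_label_range; lia.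
  by rewrite -lt /= inE xa.
have ltn' x : x \in labels b -> (x < (m + k).+2)%N.
  move=> xa; suff : x \in label_range (m + k).+1 by rewrite in_label_range; lia.
  by rewrite -lt /= inE xa orbT.
have [da db _] := distinct_node (trees_distinct tn).
have tot : total_weight alpha theta a b = (m + k)%:R + theta.
  by rewrite total_weightE nt -natr1 addrK.
rewrite grow_node tot mulrC; congr (_ * (_ + _ + _)).
- rewrite /= eqSS eq_sym std_leaf (std_id lt); ring.
- have -> : grow (m + k).+2 (fun a' => split_fun m.+1 phi F (Node a' b)) a =
      split_fun m (fun B => phi ((m + k).+2 |` B)%fset)
        (fun a' b' => grow m.+1 (fun a'' => F a'' b') a') (Node a b).
    rewrite /= -[in RHS](eqSS _ m); case: (eqVneq (nleaves a).+1 m.+1) => am.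
      rewrite -am -(grow_std (F^~ (std b)) da ltn) -growZ.
      apply: eq_grow => e et.
      by rewrite nleaves_graft // am eqxx labels_graft // !mul1r.
    rewrite !mul0r -[RHS](mul0r (grow (m + k).+2 (fun=> 0) a)) -growZ.
    apply: eq_grow => e et.
    by rewrite nleaves_graft // (negbTE am) !mul0r.
  rewrite /= /first_weight; case: eqVneq => [->//|_]; rewrite !mul0r; ring.
- have -> : grow (m + k).+2 (fun b' => split_fun m.+1 phi F (Node a b')) b =
      split_fun m.+1 phi (fun a' => grow k.+1 (F a')) (Node a b).
    rewrite /= ; case: (eqVneq (nleaves a) m.+1) => am; last first.
      rewrite !mul0r -[RHS](mul0r (grow (m + k).+2 (fun=> 0) b)) -growZ.
      apply: eq_grow => e et.
      by rewrite !mul0r.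
    have bk : nleaves b = k by move: nt => /=; rewrite am; lia.
    rewrite -[in RHS]bk -(grow_std (F (std a)) db ltn') -growZ //.
  rewrite /= /second_weight; case: (eqVneq (nleaves a) m.+1) => [am1|_].
    by have -> : nleaves b = k by move: nt => /=; rewrite am1; lia.
  by rewrite !mul0r !mulr0.
Qed.

(** By induction on [m + k]: each term of the one-step recursion factors, and
    the second factors agree because growing one of two independent trees
    before averaging is what [mean] does. *)
Lemma mean_split_indep (m k : nat) phi F :
  mean_split (m + k).+2 m.+1 phi F =
  mean_split (m + k).+2 m.+1 phi (fun _ _ => 1)
  * mean m.+1 (fun a => mean k.+1 (F a)).
Proof.
move: {2}(m + k)%N (leqnn (m + k)) => n.
elim: n m k phi F => [|n IHn] m k phi F mkn.
  have [-> ->] : m = 0%N /\ k = 0%N by lia.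
  by rewrite /mean_split /= !grow_leaf /= !std_leaf !mulr1.
have [mk0|mk0] := posnP (m + k); first by apply: IHn; lia.
have first_grows psi : mean_split (m + k).+1 m psi
      (fun a b => grow m.+1 (fun a' => F a' b) a) =
    mean_split (m + k).+1 m psi (fun _ _ => 1)
    * mean m.+1 (fun a => mean k.+1 (F a)).
  case: m mkn mk0 => [|m] mkn mk0; first by rewrite !mean_split0 mul0r.
  rewrite addSn IHn //.
  congr (_ * _); rewrite [RHS]meanS //; apply: eq_mean => a _.
  by rewrite mean_grow.
have second_grows : mean_split (m + k).+1 m.+1 phi (fun a => grow k.+1 (F a)) =
    mean_split (m + k).+1 m.+1 phi (fun _ _ => 1)
    * mean m.+1 (fun a => mean k.+1 (F a)).
  case: k {first_grows} mkn mk0 => [|k] mkn mk0.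
    by rewrite !mean_split_ge ?addn0 // mul0r.
  by rewrite addnS IHn //; lia.
rewrite !mean_split_step // first_grows second_grows.
under [in RHS]eq_mean_split do rewrite grow_cst.
under [X in _ = (_ + _ * X) / _ * _]eq_mean_split do rewrite grow_cst.
case: eqP => [->|_]; last by rewrite !mul0r; ring.
by rewrite add0n mean_cst //= mulr1; ring.
Qed.
End Mean.

(** * The splitting rule *)

Section Rule.
Context {R : realType}.
Implicit Types (x alpha theta : R).

Lemma rising0 x : rising x 0 = 1.
Proof. by rewrite /rising big_ord0. Qed.

Lemma risingS x n : rising x n.+1 = rising x n * (x + n%:R).
Proof. by rewrite /rising big_ord_recr. Qed.

Lemma risingD x m n : rising x (m + n) = rising x m * rising (x + m%:R) n.
Proof.
elim: n => [|n IHn]; first by rewrite addn0 rising0 mulr1.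
by rewrite addnS !risingS IHn natrD -mulrA addrA.
Qed.

Lemma risingSl x n : rising x n.+1 = x * rising (1 + x) n.
Proof. by rewrite -add1n risingD risingS rising0 mul1r addr0 addrC. Qed.

Lemma rising_gt0 x n : 0 < x -> 0 < rising x n.
Proof.
by move=> x0; apply: prodr_gt0 => i _; rewrite ltr_wpDr.
Qed.

(** The probability of a given first split into blocks of sizes [m.+1] and
    [k.+1], the second one containing label 1, when label 2 is in the first
    block. That block is then present from time 2 on, and the product of the
    weights used is independent of the order in which the blocks grow. *)
Definition early_prob alpha theta (m k : nat) : R :=
  rising (1 - alpha) m * rising theta k / rising (1 + theta) (m + k).

(** The same when label 2 is in the second block. The first block is then
    created by a leaf [j.+1] on the root edge, with [j] at least 2, when the
    second block has [j] labels; the factors of the second block cancel against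
    the denominators, so that [j] disappears. *)
Definition late_prob alpha theta (m k : nat) : R :=
  alpha * rising (1 - alpha) m / rising (k%:R + theta) m.+1.

(** Besides labels 1 and 2 there are [m + k] labels, of which the first block
    takes [m] if it contains 2, and [m.+1] otherwise. *)
Definition split_prob alpha theta (m k : nat) : R :=
  'C(m + k, m)%:R * early_prob alpha theta m k
  + 'C(m + k, m.+1)%:R * late_prob alpha theta m k.

Lemma early_prob_first alpha theta m k : 0 <= theta ->
  early_prob alpha theta m.+1 k * ((m + k).+1%:R + theta) =
  (m.+1%:R - alpha) * early_prob alpha theta m k.
Proof.
move=> t0; rewrite /early_prob addSn !risingS.
have n0 : rising (1 + theta) (m + k) != 0 by rewrite gt_eqF ?rising_gt0 //; lra.
have n1 : 1 + theta + (m + k)%:R != 0 by rewrite gt_eqF // ltr_wpDr //; lra.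
move: (m + k)%N n0 n1 => n n0 n1; rewrite -!natr1; field; by rewrite n0 n1.
Qed.

Lemma early_prob_second alpha theta m k : 0 <= theta ->
  early_prob alpha theta m k.+1 * ((m + k).+1%:R + theta) =
  (k%:R + theta) * early_prob alpha theta m k.
Proof.
move=> t0; rewrite /early_prob addnS !risingS.
have n0 : rising (1 + theta) (m + k) != 0 by rewrite gt_eqF ?rising_gt0 //; lra.
have n1 : 1 + theta + (m + k)%:R != 0 by rewrite gt_eqF // ltr_wpDr //; lra.
move: (m + k)%N n0 n1 => n n0 n1; rewrite -!natr1; field; by rewrite n0 n1.
Qed.

Lemma late_prob_first alpha theta m k : 0 <= theta ->
  late_prob alpha theta m.+1 k.+1 * ((m + k).+2%:R + theta) =
  (m.+1%:R - alpha) * late_prob alpha theta m k.+1.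
Proof.
move=> t0; rewrite /late_prob [rising (1 - _) _]risingS [rising (_ + _) m.+2]risingS.
have n0 : rising (k.+1%:R + theta) m.+1 != 0.
  by rewrite gt_eqF ?rising_gt0 // ltr_pwDl.
have n1 : k.+1%:R + theta + m.+1%:R != 0.
  by rewrite gt_eqF // ltr_pwDr // addr_ge0.
have -> : (m + k).+2%:R = k.+1%:R + m.+1%:R :> R.
  by rewrite -natrD; congr _%:R; lia.
rewrite -!natr1 in n0 n1 *; field; by rewrite n0 n1.
Qed.

Lemma late_prob_second alpha theta m k : 0 <= theta -> (0 < k)%N ->
  late_prob alpha theta m k.+1 * ((m + k).+1%:R + theta) =
  (k%:R + theta) * late_prob alpha theta m k.
Proof.
move=> t0 k_gt0; rewrite /late_prob.
have k0 : 0 < k%:R + theta by rewrite ltr_pwDl // ltr0n.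
have k1 : 0 < k.+1%:R + theta by rewrite ltr_pwDl.
have n0 := rising_gt0 m.+1 k0.
have n1 := rising_gt0 m.+1 k1.
have shift : (k%:R + theta) * rising (k.+1%:R + theta) m.+1 =
    rising (k%:R + theta) m.+1 * ((m + k).+1%:R + theta).
  transitivity (rising (k%:R + theta) m.+2).
    rewrite [RHS]risingSl.
    by have -> : 1 + (k%:R + theta) = k.+1%:R + theta by rewrite -natr1; ring.
  by rewrite risingS; congr (_ * _); rewrite -!natr1 natrD; ring.
have -> : (m + k).+1%:R + theta =
    (k%:R + theta) * rising (k.+1%:R + theta) m.+1
    / rising (k%:R + theta) m.+1 :> R.
  by rewrite shift mulrAC divff ?mul1r // gt_eqF.
by field; rewrite !gt_eqF.
Qed.

Lemma split_prob_first_split alpha theta : split_prob alpha theta 0 0 = 1.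
Proof.
by rewrite /split_prob /early_prob !rising0 bin0 bin_small // divr1 !mul1r mul0r addr0.
Qed.

(** The factor [k] stands for the coefficient of this term; it covers [k = 0],
    where [late_prob] may have denominator 0. *)
Lemma late_prob0 alpha theta k : 0 <= theta ->
  k%:R * late_prob alpha theta 0 k * (k%:R + theta) = k%:R * alpha.
Proof.
move=> t0; case: k => [|k]; first by rewrite !mul0r.
rewrite /late_prob rising0 risingS rising0 addr0 mulr1 mul1r -mulrA divfK //.
by rewrite gt_eqF // ltr_pwDl.
Qed.

(** The recursion of [mean_split_step] for the sizes alone. The probabilities of
    given blocks are multiplied by the weight of the growing side, and Pascal's
    rule splits the number of blocks by the side of the last label. *)
Lemma split_prob_step alpha theta m k : 0 <= theta -> (0 < m + k)%N ->
  split_prob alpha theta m k * ((m + k)%:R + theta) =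
  (m == 0%N)%:R * alpha
  + (if m is m'.+1 then (m%:R - alpha) * split_prob alpha theta m' k else 0)
  + (if k is k'.+1 then (k'%:R + theta) * split_prob alpha theta m k' else 0).
Proof.
move=> t0; rewrite /split_prob mulrDl.
case: m k => [|m] [|k] // _.
- rewrite !bin0 !mul1r !add0n addr0 !bin1 late_prob0 //.
  have el := late_prob0 alpha k t0; have ee := early_prob_second alpha 0 k t0.
  rewrite add0n in ee; rewrite ee -natr1 [(k%:R + 1) * alpha]mulrDl mul1r -el; ring.
- rewrite !addn0 !binn !(bin_small (ltnSn _)) !mul0r !addr0 !mul1r add0r.
  by rewrite -early_prob_first // addn0.
- have pascal j : 'C(m.+1 + k.+1, j.+1)%:R =
      'C(m.+1 + k, j.+1)%:R + 'C(m.+1 + k, j)%:R :> R.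
    by rewrite -natrD addnS -binS.
  have mkE : (m + k.+1 = m.+1 + k)%N by rewrite addnS.
  have ef := early_prob_first alpha m k.+1 t0.
  have es := early_prob_second alpha m.+1 k t0.
  have lf := late_prob_first alpha m k t0.
  (* For [k = 0] the rule for [late_prob] may divide by 0, but no block that
     avoids label 2 has the required size. *)
  have ls : 'C(m.+1 + k, m.+2)%:R
       * (late_prob alpha theta m.+1 k.+1 * ((m.+1 + k.+1)%:R + theta)) =
     'C(m.+1 + k, m.+2)%:R * ((k%:R + theta) * late_prob alpha theta m.+1 k).
    case: k {ef es lf pascal mkE} => [|k].
      by rewrite addn0 bin_small // !mul0r.
    by rewrite [(m.+1 + k.+2)%N]addnS late_prob_second.
  rewrite -addSn in ef; rewrite -addnS in es; rewrite -addnS -addSn in lf.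
  rewrite mul0r add0r mkE !pascal.
  move: 'C(_, m)%:R 'C(_, m.+1)%:R 'C(_, m.+2)%:R ls => A B D ls.
  move: (early_prob _ _ m.+1 k.+1) (late_prob _ _ m.+1 k.+1)
    ((m.+1 + k.+1)%:R + theta)
    ef es lf ls => E L Tot ef es lf ls.
  transitivity (A * (E * Tot) + B * (E * Tot) + B * (L * Tot) + D * (L * Tot)).
    by ring.
  by rewrite {1}ef es {1}lf ls; ring.
Qed.

Lemma mean_split_prob alpha theta m k : 0 <= theta ->
  mean_split alpha theta (m + k).+2 m.+1 (fun=> 1) (fun _ _ => 1) =
  split_prob alpha theta m k.
Proof.
move=> t0; move: {2}(m + k)%N (leqnn (m + k)) => n.
elim: n m k => [|n IHn] m k mkn.
  have [-> ->] : m = 0%N /\ k = 0%N by lia.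
  by rewrite split_prob_first_split /mean_split /= !grow_leaf /= !mulr1.
have [mk0|mk0] := posnP (m + k); first by apply: IHn; lia.
have T0 : (m + k)%:R + theta != 0 by rewrite gt_eqF // ltr_pwDl // ltr0n.
apply: (mulIf T0); rewrite split_prob_step // mean_split_step // divfK //.
rewrite mean_cst // !mulr1.
have grow1 a i : grow alpha theta i (fun=> 1) a = 1 by exact: grow_cst.
congr (_ + _ + _).
- case: m {T0} mkn mk0 => [|m] mkn mk0; first by rewrite mean_split0 mulr0.
  rewrite addSn -IHn //; congr (_ * _).
  by apply: eq_mean_split => a b; rewrite grow1.
- case: k {T0} mkn mk0 => [|k] mkn mk0.
    by rewrite mean_split_ge ?addn0 // mulr0.
  rewrite addnS -IHn; last by lia.
  congr (_ * _); first by rewrite -natr1; ring.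
  by apply: eq_mean_split => a b; rewrite grow1.
Qed.

(** The numerator of the formula is a sum of two terms, with [theta] and
    [alpha]; absorbing the factors [m.+1] and [k] into the binomial coefficient
    turns them into the two terms of [split_prob]. *)
Lemma q_formulaE alpha theta m k : 0 <= theta -> (0 < k)%N || (0 < theta) ->
  q_formula alpha theta (m + k).+1 m.+1 = split_prob alpha theta m k.
Proof.
move=> t0 pos; rewrite /q_formula /=.
have k0 : 0 < k%:R + theta.
  by case/orP: pos => h; [rewrite ltr_pwDl ?ltr0n|rewrite ltr_wpDl].
have -> : (m + k).+1%:R - m.+1%:R + theta = k%:R + theta.
  by rewrite -!natr1 natrD; ring.
have nN : (m + k).+1%:R != 0 :> R by rewrite pnatr_eq0.
have nk : rising (k%:R + theta) m.+1 != 0 by rewrite gt_eqF ?rising_gt0.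
have n1 : rising (1 + theta) (m + k) != 0 by rewrite gt_eqF ?rising_gt0 //; lra.
have binE : 'C((m + k).+1, m.+1)%:R * m.+1%:R =
    (m + k).+1%:R * 'C(m + k, m)%:R :> R.
  by rewrite -!natrM mul_bin_diag mulnC.
have binL : 'C((m + k).+1, m.+1)%:R * k%:R =
    (m + k).+1%:R * 'C(m + k, m.+1)%:R :> R.
  rewrite -!natrM -[(m + k)%N in RHS]/(m + k).+1.-1 mul_bin_down mulnC.
  by congr (_ * _)%:R; lia.
have early_probE : early_prob alpha theta m k =
    theta * rising (1 - alpha) m / rising (k%:R + theta) m.+1.
  rewrite /early_prob.
  have re : rising theta k * rising (k%:R + theta) m.+1 =
      theta * rising (1 + theta) (m + k).
    by rewrite -risingSl addrC -risingD; congr rising; lia.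
  have -> : rising theta k =
      theta * rising (1 + theta) (m + k) / rising (k%:R + theta) m.+1.
    by rewrite -re mulfK.
  by field; rewrite nk n1.
rewrite /split_prob early_probE /late_prob.
have -> : 'C((m + k).+1, m.+1)%:R
    * (((m + k).+1%:R * alpha - m.+1%:R * alpha + m.+1%:R * theta)
      / (m + k).+1%:R)
   = 'C(m + k, m.+1)%:R * alpha + 'C(m + k, m)%:R * theta :> R.
  apply: (mulIf nN); rewrite -mulrA divfK //.
  transitivity ('C((m + k).+1, m.+1)%:R * k%:R * alpha
    + 'C((m + k).+1, m.+1)%:R * m.+1%:R * theta :> R).
    by rewrite -!natr1 natrD; ring.
  by rewrite binL binE; ring.
by ring.
Qed.

Lemma cvg_rising (f : R -> R) (n : nat) (l : R) (F : set_system R)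
    {FF : Filter F} :
  (f t @[t --> F] --> l)%classic ->
  (rising (f t) n @[t --> F] --> rising l n)%classic.
Proof.
move=> fl; elim: n => [|n IHn].
  by under eq_fun do rewrite rising0; rewrite rising0; apply: cvg_cst.
under eq_fun do rewrite risingS; rewrite risingS.
by apply: cvgM => //; apply: cvgD => //; apply: cvg_cst.
Qed.

(** For [theta = 0] and [k = 0] a factor [theta] has cancelled in [split_prob],
    which is continuous at 0 there, so that the limit is its value. *)
Lemma q_ruleE alpha theta m k : 0 <= theta ->
  q_rule alpha theta (m + k).+1 m.+1 = split_prob alpha theta m k.
Proof.
move=> t0; rewrite /q_rule eqSS; case: ifPn => [/andP[/eqP -> /eqP mk]|]; last first.
  rewrite negb_and => h; apply: q_formulaE => //; rewrite lt_def t0 andbT.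
  by case/orP: h => [->|mk]; [rewrite orbT|apply/orP; left; lia].
have -> : k = 0%N by lia.
have limE : split_prob alpha 0 m 0 = early_prob alpha 0 m 0.
  by rewrite /split_prob addn0 binn bin_small // mul1r mul0r addr0.
have prob_pos t : 0 < t ->
    q_formula alpha t (m + 0).+1 m.+1 = early_prob alpha t m 0.
  move=> t1; rewrite q_formulaE ?t1 ?orbT ?ltW //.
  by rewrite /split_prob addn0 binn bin_small // mul1r mul0r addr0.
rewrite limE; apply: cvg_lim => //.
apply: cvg_trans.
  by apply: near_eq_cvg; near=> t; rewrite prob_pos.
have cvg_id : ((t : R) @[t --> 0^'+] --> 0)%classic.
  by exact: cvg_at_right_filter.
rewrite /early_prob; apply: cvgM.
  by apply: cvgM; [exact: cvg_cst|exact: cvg_rising].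
apply: cvgV; first by rewrite gt_eqF // rising_gt0 // addr0.
by apply: cvg_rising; apply: cvgD; first exact: cvg_cst.
Unshelve. all: by end_near.
Qed.

End Rule.

(** * The law of the growth process *)

Section FiniteValued.
Local Open Scope classical_set_scope.
Context {R : realType} {d : measure_display} {X : measurableType d}.
Context {C : choiceType} {Z : X -> C} {s : seq C}.
Context (Zs : forall w, Z w \in s).
Context (mZ : forall c, measurable [set w | Z w = c]).

Lemma finite_valued_preimage (A : set C) :
  [set w | A (Z w)] =
  \bigcup_(c in [set` [seq c <- s | `[< A c >]]]) [set w | Z w = c].
Proof.
apply/seteqP; split=> [w /= AZ|w [c /= cs Zc]].
  by exists (Z w) => //=; rewrite mem_filter Zs andbT; apply/asboolP.
by move: cs; rewrite mem_filter Zc => /andP[/asboolP].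
Qed.

Lemma finite_valued_measurable (A : set C) : measurable [set w | A (Z w)].
Proof.
by rewrite finite_valued_preimage; apply: fin_bigcup_measurable.
Qed.

Lemma finite_valued_measure (mu : {measure set X -> \bar R}) (A : set C) :
  uniq s ->
  (mu [set w | A (Z w)] = \sum_(c <- s | `[< A c >]) mu [set w | Z w = c])%E.
Proof.
move=> us; rewrite finite_valued_preimage measure_fin_bigcup //; last first.
- by move=> c1 c2 _ _ [w [<- <-]].
- by rewrite -fsbig_seq ?filter_uniq // big_filter.
Qed.

End FiniteValued.

Section Law.
Local Open Scope classical_set_scope.
Context {R : realType} {alpha theta : R} {d : measure_display}.
Context {Omega : measurableType d}.
Context {P : probability Omega R}.
Context {T : nat -> Omega -> ltree}.
Context (growthT : tree_growth alpha theta P T).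

Lemma growth_edge (n : nat) (w : Omega) : (0 < n)%N ->
  exists2 e, e \in edges (T n w) & T n.+1 w = graft (T n w) e n.+1.
Proof.
case: growthT => _ T1 T2 [E step]; case: n => [//|[_|n _]].
  by exists [::]; rewrite ?T1 ?T2.
by have [//|_ Ee TS _] := step n.+2; exists (E n.+2 w).
Qed.

Lemma growth_trees (n : nat) (w : Omega) : (0 < n)%N -> T n w \in trees n.
Proof.
elim: n => [//|[_ _|n IHn _]]; first by case: growthT => _ -> _ _; rewrite inE.
have [e et ->] := growth_edge w (ltn0Sn n).
by rewrite treesS //; apply/allpairsPdep; exists (T n.+1 w), e; rewrite IHn.
Qed.

(** The tree determines its past, by undoing one graft after the other. *)
Lemma growth_past (n : nat) (w w' : Omega) : T n w = T n w' ->
  forall i, (0 < i <= n)%N -> T i w = T i w'.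
Proof.
elim: n => [|[|n] IHn] Tww' i; first by case: i.
  by case: i => [|[|i]].
have [e et TS] := growth_edge w (ltn0Sn n).
have [e' et' TS'] := growth_edge w' (ltn0Sn n).
case/andP => i0; rewrite leq_eqVlt => /predU1P[->//|]; rewrite ltnS => ilen.
move: Tww'; rewrite TS TS' => /graft_inj[]; rewrite ?fresh_label ?growth_trees //.
by move=> /IHn + _ => -> //; rewrite i0.
Qed.

(** If the value [t] is attained at [w0], then being at [t] is the same event as
    having the whole past of [w0], to which the step axiom applies. *)
Lemma growth_graft (n : nat) (t : ltree) (e : edge) : (0 < n)%N ->
  t \in trees n -> e \in edges t ->
  P [set w | T n.+1 w = graft t e n.+1] =
  (P [set w | T n w = t] * (select_prob alpha theta t e)%:E)%E.
Proof.
case: n => [//|[_|n _]] tn et.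
  move: tn et; rewrite inE => /eqP -> /=; rewrite inE => /eqP ->.
  case: growthT => _ T1 T2 _; rewrite mule1 //=.
  by congr (P _); apply/seteqP; split=> w; rewrite /= T1 T2.
have [_ _ _ [E /(_ n.+2 isT)[mE Ee TS step]]] := growthT.
have TSE : [set w | T n.+3 w = graft t e n.+3] =
    [set w | T n.+2 w = t] `&` [set w | E n.+2 w = e].
  apply/seteqP; split=> w /=; rewrite TS; last by case=> -> ->.
  by move=> /graft_inj[]; rewrite ?fresh_label ?growth_trees.
have [[w0 Tw0]|noT] := pselect (exists w, T n.+2 w = t); last first.
  have T0 : [set w | T n.+2 w = t] = set0.
    by apply/seteqP; split=> w //= Tw; apply: noT; exists w.
  by rewrite TSE T0 set0I measure0 mul0e.
have pastE : [set w | T n.+2 w = t] =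
    [set w | forall i, (1 <= i <= n.+2)%N -> T i w = T i w0].
  apply/seteqP; split=> w /=; first by rewrite -Tw0 => /growth_past.
  by rewrite -Tw0; apply; rewrite leqnn.
by rewrite TSE pastE (step (T^~ w0)) Tw0.
Qed.

Definition point_mass (n : nat) (t : ltree) : R := fine (P [set w | T n w = t]).

Lemma point_massE n t : (0 < n)%N ->
  (point_mass n t)%:E = P [set w | T n w = t].
Proof.
move=> n0; rewrite fineK // fin_num_measure //.
by apply: (growth_measurable growthT).
Qed.

Lemma mean_law (n : nat) (F : ltree -> R) : (0 < n)%N ->
  mean alpha theta n F = \sum_(t <- trees n) point_mass n t * F t.
Proof.
elim: n F => [//|[_ F _|n IHn F _]].
  rewrite /= big_seq1 /point_mass; case: growthT => _ T1 _ _.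
  rewrite (_ : [set w | _] = setT) ?probability_setT ?mul1r //.
  by apply/seteqP; split=> w //= _; rewrite T1.
rewrite meanS // IHn // [trees n.+2]treesS // big_allpairs_dep /= !big_seq.
apply: eq_bigr => t tn; rewrite /grow mulr_sumr !big_seq.
apply: eq_bigr => e et.
rewrite mulrA; congr (_ * _); apply: EFin_inj.
by rewrite EFinM !point_massE // growth_graft.
Qed.

Lemma growth_law (n : nat) (A : set ltree) : (0 < n)%N ->
  P [set w | A (T n w)] = (mean alpha theta n (fun t => (`[< A t >])%:R))%:E.
Proof.
move=> n0; rewrite mean_law //.
rewrite (finite_valued_measure (s := trees n)) ?trees_uniq //; last first.
- by move=> t; exact: (growth_measurable growthT).
- by move=> w; exact: growth_trees.
rewrite -sumEFin big_mkcond; apply: eq_bigr => t _ /=.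
by case: asboolP => _; rewrite ?mulr1 ?mulr0 ?point_massE.
Qed.

Lemma growth_measurable_set (n : nat) (A : set ltree) : (0 < n)%N ->
  measurable [set w | A (T n w)].
Proof.
move=> n0; apply: (finite_valued_measurable (s := trees n)).
- by move=> w; exact: growth_trees.
- by move=> t; exact: (growth_measurable growthT).
Qed.

Lemma growth_pair_law (m k : nat) (A : ltree -> ltree -> Prop) :
  (0 < m)%N -> (0 < k)%N ->
  (P \x P)%E [set w | A (T m w.1) (T k w.2)] =
  (mean alpha theta m
     (fun a => mean alpha theta k (fun b => (`[< A a b >])%:R)))%:E.
Proof.
move=> m0 k0; pose Z (w : Omega * Omega) := (T m w.1, T k w.2).
have rectangle (a b : ltree) : [set w | Z w = (a, b)] =
    [set w | T m w = a] `*` [set w | T k w = b].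
  by apply/seteqP; split=> -[w1 w2]; rewrite /Z /= => -[<- <-].
have mT n t : (0 < n)%N -> measurable [set w | T n w = t].
  exact: (growth_measurable growthT).
rewrite [LHS](@finite_valued_measure R _ _ _ Z
  [seq (a, b) | a <- trees m, b <- trees k] _ _ (P \x P)%E [set ab | A ab.1 ab.2]).
- rewrite big_mkcond big_allpairs_dep /= mean_law // -sumEFin.
  apply: eq_bigr => a _; rewrite mean_law // mulr_sumr -sumEFin.
  apply: eq_bigr => b _.
  case: asboolP => _; last by rewrite !mulr0.
  rewrite rectangle product_measure1E; [|exact: mT..].
  transitivity ((point_mass m a)%:E * (point_mass k b)%:E)%E.
    by rewrite !point_massE.
  by rewrite -EFinM -[true%:R]/(1 : R) mulr1.
- move=> w; apply/allpairsP; exists (Z w); split=> //=; exact: growth_trees.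
- by move=> [a b]; rewrite rectangle; apply: measurableX; apply: mT.
- by apply: allpairs_uniq => [||[? ?] [? ?]]; rewrite ?trees_uniq //.
Qed.

End Law.

(** * Unlabeled trees *)

Lemma delabel_node (a b : ltree) :
  delabel (Node a b) = ujoin (delabel a) (delabel b).
Proof. by rewrite /delabel ujoin_class. Qed.

Lemma uleaves_delabel (t : ltree) : uleaves (delabel t) = nleaves t.
Proof. by rewrite /delabel uleaves_class nleaves_tree_map. Qed.

Lemma delabel_std (t : ltree) : delabel (std t) = delabel t.
Proof. by rewrite /delabel /std /relabel tree_map_comp. Qed.

Lemma usplit_sizes_node (a b : ltree) (m k : nat) :
  usplit_sizes (delabel (Node a b)) m k <->
  (nleaves a = m /\ nleaves b = k) \/ (nleaves a = k /\ nleaves b = m).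
Proof.
rewrite delabel_node; split=> [[u [v [/ujoin_inj uv um vk]]]|].
  by case: uv um vk => -[<- <-]; rewrite !uleaves_delabel; [left|right].
move=> [[am bk]|[ak bm]].
  by exists (delabel a), (delabel b); rewrite !uleaves_delabel.
exists (delabel b), (delabel a); rewrite !uleaves_delabel; split=> //.
by apply/ujoin_inj; right.
Qed.

(** * Markov branching and regeneration *)

Section Branching.
Local Open Scope classical_set_scope.
Context {R : realType} {alpha theta : R} (theta_ge0 : 0 <= theta).
Context {d : measure_display} {Omega : measurableType d}.
Context {P : probability Omega R}.
Context {T : nat -> Omega -> ltree}.
Context (growthT : tree_growth alpha theta P T).

Local Notation mean := (mean alpha theta).
Local Notation mean_split := (mean_split alpha theta).

Lemma cond_prob_mean (n : nat) (A E : set ltree) (F G : ltree -> R) (c : R) :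
  (0 < n)%N -> (0 < P [set w | E (T n w)])%E ->
  {in trees n, forall t, (`[< A t /\ E t >])%:R = F t} ->
  {in trees n, forall t, (`[< E t >])%:R = G t} ->
  mean n F = mean n G * c ->
  cond_prob P [set w | A (T n w)] [set w | E (T n w)] = c.
Proof.
move=> n0 Epos AF EG FG; rewrite /cond_prob.
have EE : P [set w | E (T n w)] = (mean n G)%:E.
  by rewrite (growth_law growthT) //; congr _%:E; apply: eq_mean.
have AE : P ([set w | A (T n w)] `&` [set w | E (T n w)]) = (mean n F)%:E.
  rewrite [LHS](growth_law growthT (fun t => A t /\ E t)) //.
  by congr _%:E; apply: eq_mean.
rewrite AE EE /= FG mulrAC divff ?mul1r // gt_eqF //.
by rewrite -lte_fin -EE.
Qed.

(** Unlabeled trees do not see the order of the subtrees, so the sizes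
    [m.+1], [k.+1] occur in both orders, which coincide when [m = k]. The
    functions of the unordered pair of subtrees that occur here are symmetric,
    hence both orders have the same conditional law, by [mean_exchange]. *)
Lemma growth_markov_branching :
  markov_branching P (fun n w => delabel (T n w)) (q_circ alpha theta).
Proof.
split=> [n u n0|n w n0|n m m0 mn /=].
- exact: (growth_measurable_set growthT (fun t => delabel t = u) n0).
- by rewrite uleaves_delabel; have [] := trees_labels (growth_trees growthT w n0).
case: m m0 mn => [//|m] _ mn.
have [k nE] : exists k, n = (m + k).+2 by exists (n - m.+2)%N; lia.
subst n; have -> : ((m + k).+2 - m.+1 = k.+1)%N by lia.
pose split_sum F t : R := split_fun m.+1 (fun=> 1) F t
  + (m != k)%:R * split_fun k.+1 (fun=> 1) F t.
have split_indicator (A : set utree) :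
    {in trees (m + k).+2, forall t,
      (`[< A (delabel t) /\ usplit_sizes (delabel t) m.+1 k.+1 >])%:R =
      split_sum (fun a b => (`[< A (ujoin (delabel a) (delabel b)) >])%:R) t}.
  move=> [x|a b] tn; have [_ nt] := trees_labels tn; first by move: nt.
  have -> : `[< A (delabel (Node a b)) /\
                usplit_sizes (delabel (Node a b)) m.+1 k.+1 >] =
      ((nleaves a == m.+1) || (nleaves a == k.+1))
      && `[< A (ujoin (delabel a) (delabel b)) >].
    rewrite -delabel_node andbC asbool_and; congr (_ && _).
    apply/asboolP/orP => [/usplit_sizes_node|ab].
      by case=> -[-> _]; [left|right].
    by apply/usplit_sizes_node; move: ab nt => /= [] /eqP ->; lia.
  rewrite /split_sum /split_fun !delabel_std !mulr1 -!natrM -natrD -!mulnb.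
  congr _%:R; case: (eqVneq m k) => [->|mk].
    by rewrite orbb mul0n addn0.
  case: (eqVneq (nleaves a) m.+1) => [->|_]; last by rewrite mul0n mul1n.
  by rewrite eqSS (negbTE mk) muln0 addn0.
have mean_split_sum F : (forall a b, F a b = F b a) ->
    mean (m + k).+2 (split_sum F) =
    q_circ alpha theta m.+1 k.+1 * mean m.+1 (fun a => mean k.+1 (F a)).
  move=> Fsym; rewrite meanD meanZ -!/(mean_split _ _ _ _).
  rewrite mean_split_indep // mean_split_prob //.
  have -> : mean_split (m + k).+2 k.+1 (fun=> 1) F =
      split_prob alpha theta k m * mean m.+1 (fun a => mean k.+1 (F a)).
    rewrite addnC mean_split_indep // mean_split_prob // mean_exchange.
    by congr (_ * _); apply: eq_mean => a _; apply: eq_mean => b _.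
  rewrite mulrA -mulrDl; congr (_ * _); rewrite /q_circ eqSS addSn addnS /=.
  rewrite q_ruleE // addnC q_ruleE //.
  by case: eqP => _; rewrite ?mul0r ?addr0 ?mul1r.
have n0 : (0 < (m + k).+2)%N by [].
have sizesE : {in trees (m + k).+2, forall t,
    (`[< usplit_sizes (delabel t) m.+1 k.+1 >])%:R = split_sum (fun _ _ => 1) t}.
  by move=> t tn; have := split_indicator setT t tn; rewrite asbool_and asboolT.
split=> [|sizes_gt0 A].
  rewrite (growth_law growthT (fun t => usplit_sizes (delabel t) m.+1 k.+1)) //.
  congr _%:E; rewrite (eq_mean _ _ sizesE) mean_split_sum //.
  by rewrite mean_cst // mean_cst // mulr1.
rewrite (growth_pair_law growthT (fun a b => A (ujoin (delabel a) (delabel b)))) //.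
congr _%:E.
apply: (cond_prob_mean (A := fun t => A (delabel t))
  (E := fun t => usplit_sizes (delabel t) m.+1 k.+1) n0 sizes_gt0
  (split_indicator A) sizesE).
rewrite !mean_split_sum //; last first.
  by move=> a b; congr (`[< A _ >])%:R; apply/ujoin_inj; right.
by rewrite [in RHS]mean_cst // mean_cst // mulr1.
Qed.

(** Either of the two blocks can be the label set of the first subtree; the two
    cases exclude each other and both lead to the same product. *)
Lemma growth_regenerative : regenerative P T.
Proof.
move=> n m B n0 Bn Bm C split0 split_gt0 A1 A2.
have CB : (label_range n `\` C)%fset = B by rewrite fsetDK.
have [w splitw] : exists w, first_split_is (T n w) B C.
  apply: contrapT => nosplit; move: split_gt0.
  rewrite (_ : split0 = set0) ?measure0 ?ltxx //.
  by apply/seteqP; split=> w // splitw; apply: nosplit; exists w.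
have Cnm : #|` C| = (n - m)%N.
  by rewrite cardfsD (fsetIidPr Bn) card_label_range Bm.
have [[m' k'] [mE kE]] : exists mk, m = mk.1.+1 /\ (n - m = mk.2.+1)%N.
  exists (m.-1, (n - m).-1).
  have ne t : (0 < #|` labels t|)%N.
    rewrite cardfs_gt0; apply/fset0Pn; exists (min_label t).
    exact: min_label_in.
  case: (T n w) splitw => //= a b.
  by rewrite -Cnm -Bm => /orP[] /andP[/eqP <- /eqP <-]; rewrite !prednK.
rewrite /= in mE kE; have nE : n = (m' + k').+2 by lia.
have neqBC : B != C.
  apply/eqP => eBC; have /fsetP/(_ 1%N) := eBC.
  by rewrite in_fsetD in_label_range n0 andbT; case: (_ \in _).
pose split_sum F t : R := split_fun m (fun D => (D == B)%:R) F t
  + split_fun (n - m) (fun D => (D == C)%:R) (fun a b => F b a) t.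
have split_indicator (A A' : set ltree) : {in trees n, forall t,
    (`[< (A (relabel B (split_subtree t B)) /\
          A' (relabel C (split_subtree t C)))
         /\ first_split_is t B C >])%:R =
    split_sum (fun a b => (`[< A a /\ A' b >])%:R) t}.
  move=> [x|a b] tn.
    by rewrite /split_sum /= addr0 asboolF //; case.
  have [da db _] := distinct_node (trees_distinct tn).
  have lb := trees_second_labels tn.
  have first_blocks : first_split_is (Node a b) B C =
      (labels a == B) || (labels a == C).
    rewrite /= lb; case: eqVneq => [->|_] /=; first by rewrite eqxx.
    by case: eqVneq => [->|_] //=; rewrite CB eqxx.
  rewrite asbool_and asboolb first_blocks /split_sum /split_fun -(eqP da) -Cnm -Bm.
  case: (eqVneq (labels a) B) => [aB|naB].
    have bC : labels b = C by rewrite lb aB.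
    rewrite aB eqxx (negbTE neqBC) mulr0 mul0r addr0 !mul1r andbT /=.
    by rewrite aB eqxx (negbTE neqBC) /std aB bC.
  rewrite mulr0 mul0r add0r; case: (eqVneq (labels a) C) => [aC|naC].
    have bB : labels b = B by rewrite lb aC.
    rewrite aC eqxx !mul1r andbT /= aC eqxx eq_sym (negbTE neqBC).
    by rewrite /std aC bB.
  by rewrite mulr0 mul0r andbF.
pose M A A' : R :=
  mean m (fun a => mean (n - m) (fun b => (`[< A a /\ A' b >])%:R)).
pose q : R := mean_split n m (fun D => (D == B)%:R) (fun _ _ => 1)
  + mean_split n (n - m) (fun D => (D == C)%:R) (fun _ _ => 1).
have mean_split_sum A A' :
    mean n (split_sum (fun a b => (`[< A a /\ A' b >])%:R)) = q * M A A'.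
  rewrite /q mulrDl meanD; congr (_ + _).
    rewrite /M kE mE nE; exact: mean_split_indep.
  rewrite /M mean_exchange kE mE nE addnC; exact: mean_split_indep.
have ME A A' : (M A A')%:E =
    (P [set w | A (T m w)] * P [set w | A' (T (n - m) w)])%E.
  have m0 : (0 < m)%N by rewrite mE.
  have k0 : (0 < n - m)%N by rewrite kE.
  rewrite (growth_law growthT A m0) (growth_law growthT A' k0) -EFinM.
  congr _%:E; rewrite [RHS]mulrC -meanZ; apply: eq_mean => a _.
  rewrite [RHS]mulrC -meanZ; apply: eq_mean => b _.
  by rewrite asbool_and -natrM mulnb.
have M1 : M setT setT = 1.
  by apply: EFin_inj; rewrite ME !probability_setT mule1.
have splitE : {in trees n, forall t,
    (`[< first_split_is t B C >])%:R = split_sum (fun _ _ => 1) t}.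
  move=> t tn; have := split_indicator setT setT t tn.
  by rewrite asbool_and asboolT.
rewrite -ME; congr _%:E.
apply: (cond_prob_mean (A := fun t => A1 (relabel B (split_subtree t B)) /\
    A2 (relabel C (split_subtree t C))) (E := fun t => first_split_is t B C)
  n0 split_gt0 (split_indicator A1 A2) splitE).
rewrite mean_split_sum; congr (_ * _).
have := mean_split_sum setT setT; rewrite M1 mulr1 => <-.
apply: eq_mean => t tn.
by rewrite -split_indicator // -splitE // asbool_and asboolT.
Qed.

End Branching.

Theorem proposition11 (R : realType) (alpha theta : R)
    (alpha_ge0 : 0 <= alpha) (alpha_le1 : alpha <= 1) (theta_ge0 : 0 <= theta)
    (d : measure_display) (Omega : measurableType d)
    (P : probability Omega R) (T : nat -> Omega -> ltree)
    (growthT : tree_growth alpha theta P T) :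
  markov_branching P (fun n w => delabel (T n w)) (q_circ alpha theta) /\
  regenerative P T.
Proof.
split; [exact: (growth_markov_branching theta_ge0 growthT)|
  exact: (growth_regenerative theta_ge0 growthT)].
Qed.
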